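(* Let $(X,d)$ be a locally compact metric Baire space and let $G$ be a homeomorphism group of $X$ satisfying the following two conditions: (1) there exists a dense non-closed orbit of the group $G$ in $X$; (2) the union of the minimal sets of $G$ is a proper dense subset of $X$. Then $G$ is sensitive to initial conditions on $(X,d)$. Moreover, $G$ is sensitive to initial conditions on every metric space $(X,\rho)$ such that $\rho$ and $d$ define the same metric topology on $X$.
   Context: A homeomorphism group of $X$ is a group of homeomorphisms of $X$ onto itself (no topology on the group is assumed). The orbit of $x$ is $G.x=\{g.x : g\in G\}$; a closed (non-closed) orbit is an orbit that is (is not) a closed subset of $X$. A minimal set of $G$ is a nonempty closed $G$-invariant subset of $X$ in which every orbit of its points is dense (equivalently, it contains no proper nonempty closed $G$-invariant subset). A Baire space is a topological space in which every countable intersection of open dense subsets is dense. A Hausdorff space is locally compact if each of its points has an open neighborhood with compact closure. A homeomorphism group $G$ of a metric space $(X,d)$ is sensitive to initial conditions if there exists $\delta>0$ such that for every nonempty open subset $U\subset X$ there exists $g\in G$ with $\operatorname{diam}(g.U)\ge\delta$ (the diameter is taken in $[0,\infty]$). *)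

(* Defs.v *)
From HB Require Import structures.
From mathcomp Require Import all_boot all_order all_algebra.
From mathcomp Require Import all_classical all_reals.
From mathcomp Require Import topology ereal.

Set Implicit Arguments.
Unset Strict Implicit.
Unset Printing Implicit Defensive.

Import Order.TTheory GRing.Theory Num.Theory.

Local Open Scope classical_set_scope.
Local Open Scope ring_scope.

Section Topology.
Context {T : topologicalType}.
Implicit Types (f g h : T -> T) (G : set (T -> T)) (x : T) (M : set T).

Definition homeomorphism f :=
  continuous f /\ exists g, [/\ continuous g, cancel f g & cancel g f].

Record homeo_group G : Prop := HomeoGroup {
  homeo_groupP : forall g, G g -> homeomorphism g;
  homeo_group1 : G id;
  homeo_groupM : forall g h, G g -> G h -> G (g \o h);
  homeo_groupV : forall g h, G g -> cancel g h -> cancel h g -> G h }.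

Definition gorbit G x : set T := [set g x | g in G].

Definition invariant_set G M := forall g, G g -> g @` M `<=` M.

(* The last clause is density of the orbits in M, not in T. *)
Definition minimal_set G M :=
  [/\ M !=set0, closed M, invariant_set G M &
      forall x, M x -> M `<=` closure (gorbit G x)].

Definition union_minimal_sets G : set T := \bigcup_(M in minimal_set G) M.

End Topology.

Definition baire_space (T : topologicalType) :=
  forall F : nat -> set T,
    (forall i, open (F i) /\ dense (F i)) -> dense (\bigcap_i F i).

Section Metric.
Context {R : realType}.

(* Metrics are also handled as plain functions, so that several of them can be
   considered on the same carrier. *)
Record is_metric {T : Type} (rho : T -> T -> R) : Prop := IsMetric {
  is_metric_ge0 : forall x y, 0 <= rho x y;
  is_metric_eq0 : forall x y, rho x y = 0 <-> x = y;
  is_metric_sym : forall x y, rho x y = rho y x;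
  is_metric_triangle : forall x y z, rho x z <= rho x y + rho y z }.

Definition metrizes {T : topologicalType} (rho : T -> T -> R) :=
  forall A : set T, open A <->
    (forall x, A x -> exists2 e : R, 0 < e & [set y | rho x y < e] `<=` A).

(* Supremum in the extended reals; it is -oo on the empty set, but sensitivity
   only uses diameters of nonempty sets. *)
Definition diam {T : Type} (rho : T -> T -> R) (A : set T) : \bar R :=
  ereal_sup [set (rho p.1 p.2)%:E | p in A `*` A].

Definition sensitive {T : topologicalType} (rho : T -> T -> R)
    (G : set (T -> T)) :=
  exists2 delta : R, 0 < delta &
    forall U : set T, open U -> U !=set0 ->
      exists2 g, G g & (delta%:E <= diam rho (g @` U))%E.

End Metric.

(* Main.v *)
Require Import Defs.
From HB Require Import structures.
From mathcomp Require Import all_boot all_order all_algebra.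
From mathcomp Require Import all_classical all_reals.
From mathcomp Require Import topology ereal.
From mathcomp Require Import lra.

Import Order.TTheory GRing.Theory Num.Theory.

Local Open Scope classical_set_scope.
Local Open Scope ring_scope.

(** If [G] is not sensitive, then for every [e] the open sets all of whose
    translates have diameter less than [e] meet a given dense orbit [G x], so by
    invariance one of them contains [x]: the group acts equicontinuously at [x].
    Then the closure of every orbit [G y] contains [x]: pick a point [m] near
    [x] in a minimal set [M] and elements [g] of [G] with [g x] tending to [y].
    By equicontinuity [g m] stays in a compact neighbourhood of [y], hence
    clusters at some [m'] in [M], and minimality gives [h] in [G] with [h m']
    close to [m]. Since [h (g x)] and [h (g m)] are uniformly close, [h y] is
    close to [m] and thus to [x]. So the whole space is a minimal set,
    contradicting that the union of the minimal sets is proper. *)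

Section MetrizingDistance.
Context {R : realType} {X : topologicalType} {rho : X -> X -> R}.
Hypotheses (rhoP : is_metric rho) (rhoX : metrizes rho).

Lemma rho_ball_nbhs (x : X) (e : R) : 0 < e -> nbhs x [set y | rho x y < e].
Proof.
move=> e0; rewrite nbhsE; exists [set y | rho x y < e] => //; split => /=.
  apply/rhoX => y /= xy; exists (e - rho x y); first by rewrite subr_gt0.
  move=> z /= yz; have := is_metric_triangle rhoP x y z; lra.
by rewrite (proj2 (is_metric_eq0 rhoP x x) erefl).
Qed.

Lemma nbhs_rho_ball (x : X) (A : set X) : nbhs x A ->
  exists2 e : R, 0 < e & [set y | rho x y < e] `<=` A.
Proof.
rewrite nbhsE => -[B [/rhoX oB Bx] BA].
by have [e e0 eB] := oB x Bx; exists e => //; apply: subset_trans BA.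
Qed.

Lemma rho_le_diam (A : set X) (x y : X) :
  A x -> A y -> ((rho x y)%:E <= diam rho A)%E.
Proof. by move=> Ax Ay; apply: ereal_sup_ubound; exists (x, y). Qed.

End MetrizingDistance.

Section GroupOrbits.
Context {X : topologicalType} {G : set (X -> X)}.
Hypothesis GP : homeo_group G.

Lemma minimal_setT (x : X) : dense (gorbit G x) ->
  (forall y, closure (gorbit G y) x) -> minimal_set G [set: X].
Proof.
move=> dx clx; split; [by exists x|exact: closedT|by []|].
move=> y _ z _ V Vz.
move: Vz; rewrite nbhsE => -[B [oB Bz] BV].
have [? [Bgx [g Gg gx]]] := dx B (ex_intro _ z Bz) oB; rewrite -{}gx in Bgx.
have [gcont _] := homeo_groupP GP Gg.
have : nbhs x (g @^-1` B) by apply: gcont; apply: open_nbhs_nbhs.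
move=> /(clx y) [_ [[h Gh <-]]] /= Bghy.
by exists (g (h y)); split; [exists (g \o h) => //; exact: homeo_groupM|exact: BV].
Qed.

End GroupOrbits.

Section Sensitivity.
Context {R : realType} {X : topologicalType} {rho : X -> X -> R}.
Context {G : set (X -> X)}.
Hypotheses (rhoP : is_metric rho) (rhoX : metrizes rho) (GP : homeo_group G).

Lemma not_sensitive_equicontinuous (x : X) :
  ~ sensitive rho G -> dense (gorbit G x) ->
  forall e : R, 0 < e ->
    exists2 U, nbhs x U & forall g a b, G g -> U a -> U b -> rho (g a) (g b) < e.
Proof.
move=> nsens dx e e0; apply: contrapT => nequi; apply: nsens; exists e => //.
move=> U oU U0; apply: contrapT => smallU; apply: nequi.
have [? [Uhx [h Gh gx]]] := dx U U0 oU; rewrite -{}gx in Uhx.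
have [hcont _] := homeo_groupP GP Gh.
exists (h @^-1` U); first by apply: hcont; exact: open_nbhs_nbhs.
move=> g a b Gg /= Uha Uhb.
have [_ [k [_ hk kh]]] := homeo_groupP GP Gh.
have Gk : G k := homeo_groupV GP Gh hk kh.
rewrite ltNge; apply/negP => le_e; apply: smallU.
(* Since [k] inverts [h], the map [g \o k] sends the points [h a] and [h b] of [U] to [g a] and
   [g b]. *)
exists (g \o k); first exact: homeo_groupM.
apply: (@le_trans _ _ (rho (g a) (g b))%:E); first by rewrite lee_fin.
by apply: rho_le_diam; [exists (h a)|exists (h b)] => //=; rewrite hk.
Qed.

Lemma equicontinuous_orbit_closure (x y : X) :
  locally_compact [set: X] -> dense (union_minimal_sets G) ->
  dense (gorbit G x) ->
  (forall e : R, 0 < e ->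
    exists2 U, nbhs x U & forall g a b, G g -> U a -> U b -> rho (g a) (g b) < e) ->
  closure (gorbit G y) x.
Proof.
move=> lcX dM dx equi A /(nbhs_rho_ball rhoX _ _) [e e0 eA].
have [K + [cK _]] := lcX y I; rewrite withinET => yK.
have [r r0 rK] := nbhs_rho_ball rhoX _ _ yK.
(* The bound [r / 2] will keep [g m] inside [K]; the bound [e / 4] enters the final estimate. *)
have [|U xU equiU] := equi (Num.min (e / 4) (r / 2)).
  by rewrite lt_min !divr_gt0.
have equi_e g a b : G g -> U a -> U b -> rho (g a) (g b) < e / 4.
  by move=> Gg Ua Ub; have := equiU g a b Gg Ua Ub; rewrite lt_min => /andP[].
have equi_r g a b : G g -> U a -> U b -> rho (g a) (g b) < r / 2.
  by move=> Gg Ua Ub; have := equiU g a b Gg Ua Ub; rewrite lt_min => /andP[].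
have Ux : U x := nbhs_singleton xU.
have e4 : 0 < e / 4 by rewrite divr_gt0.
have r2 : 0 < r / 2 by rewrite divr_gt0.
have [m [M minM Mm] [Um xm]] : exists2 m, union_minimal_sets G m &
    U m /\ rho x m < e / 4.
  have : nbhs x (U `&` [set m | rho x m < e / 4]).
    by apply: filterI => //; exact: rho_ball_nbhs.
  rewrite nbhsE => -[B [oB Bx] BU].
  by have [m [Bm ?]] := dM B (ex_intro _ x Bx) oB; exists m => //; exact: BU.
have [_ clM invM denseM] := minM.
(* [F] expresses that [g] runs through [G] with [g x] tending to [y]; it is proper because the orbit
   of [x] is dense. *)
pose F := filter_from (nbhs y) (fun V => [set g | G g /\ V (g x)]).
have FF : ProperFilter F.
  apply: filter_from_proper.
    apply: filter_from_filter; first by exists setT; exact: filterT.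
    move=> V W Vy Wy; exists (V `&` W); first exact: filterI.
    by move=> g [Gg [Vg Wg]].
  move=> V; rewrite nbhsE => -[B [oB By] BV].
  have [? [Bgx [g Gg gx]]] := dx B (ex_intro _ y By) oB; rewrite -{}gx in Bgx.
  by exists g; split=> //; exact: BV.
have FK : F [set g | K (g m)].
  exists [set z | rho y z < r / 2]; first exact: rho_ball_nbhs.
  move=> g /= [Gg ygx]; apply: rK => /=.
  have := equi_r g x m Gg Ux Um; have := is_metric_triangle rhoP y (g x) (g m).
  lra.
have [m' [_ m'F]] := cK ((fun g => g m) @ F) _ FK.
(* Every [g m] lies in the closed invariant set [M], hence so does the cluster point. *)
have Mm' : M m'.
  apply: clM => V Vm'.
  have : ((fun g => g m) @ F) M.
    exists setT; first exact: filterT.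
    by move=> g /= [Gg _]; apply: invM Gg _ _; exists m.
  by move=> /m'F /(_ Vm').
have [_ [[h Gh <-] /= mhm']] : gorbit G m' `&` [set z | rho m z < e / 4] !=set0.
  by apply: denseM Mm' _ Mm _ _; exact: rho_ball_nbhs.
have [hcont _] := homeo_groupP GP Gh.
have nm' : nbhs m' (h @^-1` [set z | rho (h m') z < e / 8]).
  by apply: hcont; apply: rho_ball_nbhs => //; rewrite divr_gt0.
have ny : nbhs y (h @^-1` [set z | rho (h y) z < e / 8]).
  by apply: hcont; apply: rho_ball_nbhs => //; rewrite divr_gt0.
(* The set retains the witness [g], so that a single [g] has both [g m] near [m'] and [h (g x)] near
   [h y]. *)
have Fy : ((fun g => g m) @ F)
    [set z | exists2 g, G g & z = g m /\ rho (h y) (h (g x)) < e / 8].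
  by exists (h @^-1` [set z | rho (h y) z < e / 8]) => // g [Gg ?]; exists g.
have [_ [[g Gg [-> hygx]] /= hm'gm]] := m'F _ _ Fy nm'.
exists (h y); split; first by exists h.
apply: eA => /=.
(* Along the chain [x], [m], [h m'], [h (g m)], [h (g x)], [h y] the successive distances are below
   [e / 4], [e / 4], [e / 8], [e / 4], [e / 8], which add up to [e]. *)
have := equi_e (h \o g) x m (homeo_groupM GP Gh Gg) Ux Um => /=.
have := is_metric_triangle rhoP x m (h y).
have := is_metric_triangle rhoP m (h m') (h y).
have := is_metric_triangle rhoP (h m') (h (g m)) (h y).
have := is_metric_triangle rhoP (h (g m)) (h (g x)) (h y).
rewrite (is_metric_sym rhoP (h (g m)) (h (g x))).
rewrite (is_metric_sym rhoP (h (g x)) (h y)).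
lra.
Qed.

Lemma dense_minimal_sets_sensitive (x : X) :
  locally_compact [set: X] -> dense (gorbit G x) ->
  union_minimal_sets G <> [set: X] -> dense (union_minimal_sets G) ->
  sensitive rho G.
Proof.
move=> lcX dx properM dM; apply: contrapT => nsens; apply: properM.
have minX : minimal_set G [set: X].
  apply: (minimal_setT GP x dx) => y.
  apply: equicontinuous_orbit_closure => //.
  exact: not_sensitive_equicontinuous.
by apply/seteqP; split=> // z _; exists [set: X].
Qed.

End Sensitivity.

Lemma mdist_is_metric (R : realType) (X : metricType R) : is_metric (@mdist R X).
Proof.
split; [exact: mdist_ge0| |exact: metric_sym|exact: metric_triangle].
by move=> x y; split=> [|->]; [exact: mdist_positivity|exact: mdistxx].
Qed.

Lemma mdist_metrizes (R : realType) (X : metricType R) : metrizes (@mdist R X).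
Proof.
move=> A; rewrite openE; split=> oA x /oA.
  by move=> /nbhs_ballP[e e0]; rewrite ballEmdist; exists e.
by move=> [e e0 eA]; apply/nbhs_ballP; exists e => //; rewrite ballEmdist.
Qed.

Theorem theorem1p4 (R : realType) (X : metricType R) (G : set (X -> X)) :
  locally_compact [set: X] ->
  baire_space X ->
  homeo_group G ->
  (exists x : X, dense (gorbit G x) /\ ~ closed (gorbit G x)) ->
  (union_minimal_sets G <> [set: X] /\ dense (union_minimal_sets G)) ->
  sensitive (@mdist R X) G /\
  (forall rho : X -> X -> R,
    is_metric rho -> metrizes rho -> sensitive rho G).
Proof.
move=> lcX _ GP [x [dx _]] [properM dM].
(* Both conclusions are instances of this claim, as [mdist] itself metrizes the topology. *)
have sens rho : is_metric rho -> metrizes rho -> sensitive rho G.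
  by move=> rhoP rhoX; apply: (dense_minimal_sets_sensitive rhoP rhoX GP x).
split=> //; apply: sens; [exact: mdist_is_metric|exact: mdist_metrizes].
Qed.
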